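(* For each integer $k\ge 3$, the class of graphs having no pivot-minor isomorphic to a cycle of length $k$ is $\chi$-bounded.
   Context: Graphs are finite and simple (no loops, no parallel edges). For a graph $G$, $\chi(G)$ is the chromatic number and $\omega(G)$ is the maximum size of a clique. A class $\mathcal{C}$ of graphs is $\chi$-bounded if there is a function $f:\mathbb{N}\to\mathbb{N}$ such that $\chi(H)\le f(\omega(H))$ for every $G\in\mathcal{C}$ and every induced subgraph $H$ of $G$. For a vertex $v$ of $G$ with neighborhood $N_G(v)$, local complementation at $v$ produces the graph $G*v$ obtained from $G$ by replacing the subgraph induced on $N_G(v)$ with its complement. Pivoting an edge $uv\in E(G)$ produces $G\wedge uv:=G*u*v*u$. A graph $H$ is a pivot-minor of $G$ if $H$ can be obtained from $G$ by a (possibly empty) sequence of pivotings of edges and vertex deletions. *)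

(* Defs.v *)
From HB Require Import structures.
From mathcomp Require Import all_boot.

Set Implicit Arguments.
Unset Strict Implicit.
Unset Printing Implicit Defensive.

Record sgraph := SGraph {
  vertex :> finType;
  adj : rel vertex;
  adj_sym : symmetric adj;
  adj_irrefl : irreflexive adj
}.

Definition isomorphic (G H : sgraph) : Prop :=
  exists2 f : G -> H, bijective f & forall x y : G, adj (f x) (f y) = adj x y.

Section InducedSubgraph.
Variables (G : sgraph) (S : {set G}).

Definition induced_rel : rel {x : G | x \in S} :=
  fun x y => adj (val x) (val y).

Lemma induced_sym : symmetric induced_rel.
Proof. by move=> x y; apply: adj_sym. Qed.

Lemma induced_irrefl : irreflexive induced_rel.
Proof. by move=> x; apply: adj_irrefl. Qed.

Definition induced : sgraph := SGraph induced_sym induced_irrefl.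
End InducedSubgraph.

Definition delete_vertex (G : sgraph) (v : G) : sgraph := induced [set~ v].

Section Colorings.
Variable G : sgraph.

Definition clique (S : {set G}) : bool :=
  [forall x in S, forall y in S, (x != y) ==> adj x y].

Definition omega : nat := \max_(S : {set G} | clique S) #|S|.

Definition proper_coloring (k : nat) (c : {ffun G -> 'I_k}) : bool :=
  [forall x, forall y, adj x y ==> (c x != c y)].

Definition colorable (k : nat) : bool :=
  [exists c : {ffun G -> 'I_k}, proper_coloring c].

Lemma ex_colorable : exists k, colorable k.
Proof.
exists #|G|; apply/existsP; exists [ffun x => enum_rank x].
apply/'forall_forallP => x y; apply/implyP => xy; rewrite !ffunE.
by apply: contraTneq xy => /enum_rank_inj ->; rewrite adj_irrefl.
Qed.

Definition chi : nat := ex_minn ex_colorable.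
End Colorings.

Section LocalComplementation.
Variables (G : sgraph) (v : G).

(* Exclusive or: the adjacency of x and y is flipped exactly when they are
   distinct neighbours of v. *)
Definition local_compl_rel : rel G :=
  fun x y => adj x y (+) [&& x != y, adj v x & adj v y].

Lemma local_compl_sym : symmetric local_compl_rel.
Proof.
by move=> x y; rewrite /local_compl_rel adj_sym eq_sym [adj v x && _]andbC.
Qed.

Lemma local_compl_irrefl : irreflexive local_compl_rel.
Proof. by move=> x; rewrite /local_compl_rel adj_irrefl eqxx. Qed.

Definition local_compl : sgraph := SGraph local_compl_sym local_compl_irrefl.
End LocalComplementation.

(* Local complementation keeps the vertex type, so u and v are still vertices
   of the intermediate graphs by conversion. *)
Definition pivot (G : sgraph) (u v : G) : sgraph :=
  let G1 := @local_compl G u in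
  let G2 := @local_compl G1 v in
  @local_compl G2 u.

Inductive pivot_minor (H : sgraph) : sgraph -> Prop :=
| pivot_minor_refl : pivot_minor H H
| pivot_minor_pivot (G : sgraph) (u v : G) :
    adj u v -> pivot_minor H (pivot u v) -> pivot_minor H G
| pivot_minor_delete (G : sgraph) (v : G) :
    pivot_minor H (delete_vertex v) -> pivot_minor H G.

Section Cycle.
Variable k : nat.

(* This is the cycle C_k only for 3 <= k; i != j matters only for k = 1. *)
Definition cycle_rel : rel 'I_k :=
  fun i j => (i != j) && ((j == ordS i) || (i == ordS j)).

Lemma cycle_sym : symmetric cycle_rel.
Proof. by move=> i j; rewrite /cycle_rel eq_sym orbC. Qed.

Lemma cycle_irrefl : irreflexive cycle_rel.
Proof. by move=> i; rewrite /cycle_rel eqxx. Qed.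

Definition cycle_graph : sgraph := SGraph cycle_sym cycle_irrefl.
End Cycle.

Definition no_pivot_minor_iso (F G : sgraph) : Prop :=
  ~ exists2 H : sgraph, pivot_minor H G & isomorphic H F.

Definition chi_bounded (C : sgraph -> Prop) : Prop :=
  exists f : nat -> nat, forall G : sgraph, C G ->
    forall S : {set G}, chi (induced S) <= f (omega (induced S)).

(* Main.v *)
Require Import Defs.
From mathcomp Require Import all_boot.
From mathcomp Require Import zify.

(** By induction on the clique number we may assume that neighbourhoods have
    bounded chromatic number. If the chromatic number is huge, breadth-first
    search yields a connected set [A], the set [U] of its neighbours and a set
    [X] of large chromatic number, covered by [U] and without edges to [A].
    Inside [X], grow an induced path from a vertex [u] of [U], as Gyarfas does,
    ending next to a connected set [C] of large chromatic number. For each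
    vertex of [C] choose a neighbour [w] in [U] and an induced path through [A]
    from [u] to [w]; by the pigeonhole principle all these [w] have the same
    neighbours on the first [n] vertices of the path and the same parity of
    the length of the connection to [u]. Now prolong the path into [C] up to an
    edge [ab] of [C]. Then a vertex [w] attached to [a] or to [b] sees a long
    induced path (the connection from [w] to [u] followed by the path in [X]),
    and we may choose the parity of the place of its last neighbour.

    A vertex [v] together with an induced path is encoded by a 0-1 sequence [f]
    whose second differences mod 2 record the neighbours of [v]. Pivoting an
    edge of the path and deleting its ends deletes two consecutive values of
    [f]; hence [f] may be replaced by any subsequence whose indices alternate
    in parity. Either the word of the common neighbours has many ones or it has
    a long run of zeros; in both cases such a subsequence encodes the adjacency
    word 1 0 ... 0 1 of a hole of length exactly [k], provided that the last
    neighbour has the right parity. *)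

Set Implicit Arguments.
Unset Strict Implicit.
Unset Printing Implicit Defensive.

(** * Pivoting along an induced path *)

(** The correction is the determinant over GF(2) of the two vectors that record the adjacencies of
    [p] and of [q] to [x] and [y]: a pair is flipped exactly when these vectors are nonzero and
    distinct. *)
Lemma pivot_adjE (G : sgraph) (x y p q : G) :
  adj x y -> p != x -> p != y -> q != x -> q != y ->
  @adj (pivot x y) p q
    = adj p q (+) (adj x p && adj y q (+) adj y p && adj x q).
Proof.
move=> xy px py qx qy; rewrite /pivot /= /local_compl_rel /= /local_compl_rel /=.
have yx : adj y x by rewrite adj_sym.
rewrite /local_compl_rel !adj_irrefl !(eq_sym x) !(eq_sym y) px py qx qy xy yx /=.
have [-> | _] := eqVneq p q; first by rewrite adj_irrefl; do !case: (adj _ _).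
have [exy|_] := eqVneq y x; first by rewrite exy adj_irrefl in xy.
by do !case: (adj _ _).
Qed.

(** Deleting the vertices outside the image one by one leaves a copy of [F]. *)
Lemma embed_pivot_minor (F G : sgraph) (h : F -> G) :
  injective h -> (forall x y, adj (h x) (h y) = adj x y) ->
  exists2 H, pivot_minor H G & isomorphic H F.
Proof.
have [n] := ubnP #|G|; elim: n G h => // n IHn G h leGn inj_h adj_h.
have [/forallP h_onto | /forallPn[v v_notin]] := boolP [forall v, v \in codom h].
  exists G; first exact: pivot_minor_refl.
  exists (fun x => iinv (h_onto x)).
    by exists h => x; [rewrite f_iinv | apply: inj_h; rewrite f_iinv].
  by move=> x y; rewrite -adj_h !f_iinv.
have h_in x : h x \in [set~ v].
  by rewrite !inE; apply: contraNneq v_notin => <-; apply: codom_f.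
have [| | |H HG HF] := IHn (delete_vertex v) (fun x => Sub (h x) (h_in x)).
- have: #|delete_vertex v| = #|[set~ v]| by rewrite /= card_sig.
  by rewrite cardsC1 => ->; rewrite prednK //; apply/card_gt0P; exists v.
- by move=> x y /(congr1 val)/inj_h.
- by move=> x y; apply: adj_h.
by exists H => //; apply: pivot_minor_delete HG.
Qed.

Lemma no_pivot_minor_pivot (F G : sgraph) (u v : G) :
  adj u v -> no_pivot_minor_iso F G -> no_pivot_minor_iso F (pivot u v).
Proof.
by move=> uv FG [H HG HF]; apply: FG; exists H => //; apply: pivot_minor_pivot HG.
Qed.

Definition near (i j : nat) := (i.+1 == j) || (j.+1 == i).

(* The second differences mod 2 of [f] record the adjacencies of [v] to the
   path [p 0], ..., [p n.-1]. In this encoding, pivoting an edge of the path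
   and deleting its ends amounts to deleting two consecutive values of [f]. *)
Definition path_apex (G : sgraph) (n : nat) (v : G) (p : nat -> G)
    (f : nat -> bool) :=
  [/\ forall i, i < n -> p i != v,
      {in gtn n &, injective p},
      forall i j, i < n -> j < n -> adj (p i) (p j) = near i j
    & forall i, i < n -> adj v (p i) = f i (+) f i.+2].

Lemma nearC i j : near i j = near j i.
Proof. by rewrite /near orbC. Qed.

Lemma near_lt i j : i.+1 < j -> near i j = false.
Proof. by rewrite /near; lia. Qed.

Definition skip2 (i j : nat) := if j < i then j else j.+2.

Lemma skip2_lt i j : j < i -> skip2 i j = j.
Proof. by rewrite /skip2 => ->. Qed.

Lemma skip2_ge i j : i <= j -> skip2 i j = j.+2.
Proof. by rewrite /skip2 ltnNge => ->. Qed.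

(** The pivot joins the path vertices just before and just after the edge, if they exist, which
    closes the gap. The adjacency of [v] to the former changes by [f i.+1 (+) f i.+3], and to the
    latter by [f i (+) f i.+2]; this amounts to erasing [f i.+1] and [f i.+2]. *)
Lemma path_apex_pivot (G : sgraph) (n i : nat) (v : G) (p : nat -> G)
    (f : nat -> bool) :
  path_apex n v p f -> i.+1 < n ->
  @path_apex (pivot (p i) (p i.+1)) n.-2 v (p \o skip2 i) (f \o skip2 i.+1).
Proof.
move=> [pv p_inj pp vp] i1n.
have i0n : i < n by apply: ltnW.
have pneq a b : a < n -> b < n -> a != b -> p a != p b.
  by move=> an bn; apply: contra_neq; apply: p_inj.
have xy : adj (p i) (p i.+1) by rewrite pp /near ?eqxx.
have skip_lt j : j < n.-2 -> skip2 i j < n.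
  by move=> jn; case: (ltnP j i) => ji; [rewrite skip2_lt | rewrite skip2_ge] => //; lia.
have skip_neq j : (skip2 i j != i) * (skip2 i j != i.+1).
  by case: (ltnP j i) => ji; [rewrite skip2_lt | rewrite skip2_ge] => //; split; lia.
have pivE a b : a < n.-2 -> b < n.-2 ->
    @adj (pivot (p i) (p i.+1)) (p (skip2 i a)) (p (skip2 i b))
      = near (skip2 i a) (skip2 i b)
        (+) (near i (skip2 i a) && near i.+1 (skip2 i b)
             (+) near i.+1 (skip2 i a) && near i (skip2 i b)).
  by move=> /skip_lt an /skip_lt bn; rewrite pivot_adjE ?xy ?pneq ?skip_neq ?pp.
have pivvE j : j < n.-2 ->
    @adj (pivot (p i) (p i.+1)) v (p (skip2 i j))
      = f (skip2 i j) (+) f (skip2 i j).+2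
        (+) ((f i (+) f i.+2) && near i.+1 (skip2 i j)
             (+) (f i.+1 (+) f i.+3) && near i (skip2 i j)).
  move=> /skip_lt jn; rewrite pivot_adjE ?xy ?pneq ?skip_neq ?pp ?(eq_sym v) ?pv //.
  by rewrite ![adj (p _) v]adj_sym !vp.
split=> [j jn | a b an bn | a b an bn | j jn]; rewrite /comp.
- exact/pv/skip_lt.
- move/(p_inj _ _ (skip_lt _ an) (skip_lt _ bn)).
  by rewrite /skip2; case: (ltnP a i); case: (ltnP b i); lia.
- rewrite pivE //; case: (ltnP a i) => ia; case: (ltnP b i) => ib.
  + rewrite !skip2_lt // (nearC i.+1 a) (nearC i.+1 b).
    by rewrite (@near_lt a i.+1) // (@near_lt b i.+1) // !andbF !addbF.
  + rewrite (skip2_lt ia) (skip2_ge ib) (@near_lt a b.+2); last lia.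
    rewrite (nearC i.+1 a) (@near_lt a i.+1) //= addbF /near.
    by apply/idP/idP; lia.
  + rewrite (skip2_ge ia) (skip2_lt ib) (nearC a.+2) (@near_lt b a.+2); last lia.
    rewrite (nearC i.+1 b) (@near_lt b i.+1) // andbF /= /near.
    by apply/idP/idP; lia.
  + rewrite (skip2_ge ia) (skip2_ge ib) (@near_lt i a.+2) // (@near_lt i b.+2) // andbF.
    by rewrite andFb !addbF /near !eqSS.
- rewrite pivvE //; case: (ltngtP j.+1 i) => ji.
  + rewrite (@skip2_lt i) 1?ltnW // (nearC i) (nearC i.+1).
    rewrite (@near_lt j i) // (@near_lt j i.+1) 1?ltnW // !andbF addbF.
    by rewrite !skip2_lt //; lia.
  + rewrite (@skip2_ge i j) // (@near_lt i j.+2) // andbF addbF /near !eqSS.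
    case: (ltngtP i j) => ij.
    * rewrite (_ : (j.+2 == i) = false) ?andbF ?addbF; last lia.
      by rewrite (@skip2_ge i.+1 j) // skip2_ge // ltnW // ltnW.
    * by move: ij ji; lia.
    * rewrite orTb andbT (@skip2_lt i.+1 j) ?ij // skip2_ge //.
      by case: (f j); case: (f j.+2); case: (f j.+4).
  + rewrite -ji skip2_lt // nearC /near !eqSS eqxx orbT andbT.
    rewrite (ltn_eqF (ltnSn j)) (gtn_eqF (ltnW (ltnW (ltnSn _)))) andbF.
    rewrite skip2_lt 1?ltnW // skip2_ge //.
    by case: (f j); case: (f j.+2); case: (f j.+4).
Qed.

Lemma no_induced_cycle (k : nat) (G : sgraph) (h : 'I_k -> G) :
  no_pivot_minor_iso (cycle_graph k) G -> injective h ->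
  ~ (forall i j, adj (h i) (h j) = cycle_rel i j).
Proof.
move=> noC h_inj h_adj; apply: noC.
exact: (@embed_pivot_minor (cycle_graph k) G h).
Qed.

Definition alternating (k : nat) (t : nat -> nat) :=
  forall i, i < k -> t i < t i.+1 /\ odd (t i.+1) = ~~ odd (t i).

Lemma alternating_mono k t i j :
  alternating k t -> i <= j -> j <= k -> t i + (j - i) <= t j.
Proof.
move=> tP; elim: j => [|j IHj] ij jk; first by move: ij; rewrite leqn0 => /eqP ->; lia.
have [ij'|] := leqP i j; last by move=> ?; rewrite (_ : i = j.+1); lia.
have [tj _] := tP j jk; have := IHj ij' (ltnW jk); lia.
Qed.

(** The [k.+1] selected values encode a path on [k.-1] vertices with adjacency word 1 0 ... 0 1,
    which [v] closes to a hole of length [k]. Gaps between selected indices are odd, so the values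
    to be erased between them come in consecutive pairs. *)
Lemma no_apex_run (k n : nat) (G : sgraph) (v : G) (p : nat -> G)
    (f : nat -> bool) (t : nat -> nat) :
  2 < k -> no_pivot_minor_iso (cycle_graph k) G -> path_apex n v p f ->
  alternating k t -> t k <= n.+1 ->
  f (t 0) != f (t 2) -> (forall i, 0 < i -> i.+2 < k -> f (t i) = f (t i.+2)) ->
  f (t k.-2) != f (t k) -> False.
Proof.
move=> k_gt2; elim/ltn_ind: n G v p f t => n IHn G v p f t noC apex tP tn f0 fi fk.
have [/forallP t_succ | /forallPn[i ti]] :=
  boolP [forall i : 'I_k, t i.+1 == (t i).+1].
  have tE i : i <= k -> t i = t 0 + i.
    elim: i => [|i IHi] ik; first by rewrite addn0.
    by rewrite (eqP (t_succ (Ordinal ik))) /= IHi 1?ltnW // addnS.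
  have [pv p_inj pp vp] := apex.
  have tn' j : 0 < j < k -> t 0 + j.-1 < n by rewrite tE // in tn; lia.
  pose h (i : 'I_k) := if (i : nat) is j.+1 then p (t 0 + j) else v.
  have vE j : 0 < j < k -> adj v (p (t 0 + j.-1)) = (j == 1) || (j.+1 == k).
    move=> jk; rewrite vp ?tn' //.
    have -> : (t 0 + j.-1) = t j.-1 by rewrite (tE j.-1); lia.
    have -> : (t j.-1).+2 = t j.+1 by rewrite (tE j.-1) ?(tE j.+1); lia.
    case: eqP => [->|j1] /=; first by move: f0; do 2 case: (f _).
    case: eqP => [jk'|j1'] /=.
      by move: fk; rewrite -jk' /=; do 2 case: (f _).
    have -> : t j.+1 = t j.-1.+2 by congr (t _); lia.
    by rewrite -fi ?addbb //; lia.
  apply: (@no_induced_cycle k G h noC).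
    move=> [[|i] ik] [[|j] jk] //=; rewrite /h /=.
    + by move=> _; apply: val_inj.
    + by move/eqP; rewrite eq_sym (negPf (pv _ _)) // (tn' j.+1).
    + by move/eqP; rewrite (negPf (pv _ _)) // (tn' i.+1).
    + by move/(p_inj _ _ (tn' i.+1 ik) (tn' j.+1 jk)) => e; apply: val_inj => /=; lia.
  have ordSE (i j : 'I_k) :
      (j == ordS i) = ((i.+1 == j) || (i.+1 == k) && (j == 0 :> nat)).
    rewrite -val_eqE /=; have [ik|] := ltnP i.+1 k; first by rewrite modn_small //; lia.
    move=> ki; have ik := ltn_ord i; have jk := ltn_ord j.
    by rewrite (_ : i.+1 = k) ?modnn; lia.
  move=> i j; rewrite /cycle_rel !ordSE -val_eqE.
  case: i j => [[|i] ik] [[|j] jk] //=; rewrite /h /=.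
  + by rewrite adj_irrefl.
  + by rewrite (vE j.+1 jk); lia.
  + by rewrite adj_sym (vE i.+1 ik); lia.
  + by rewrite pp ?(tn' i.+1) ?(tn' j.+1) // /near; lia.
have ik := ltn_ord i; have [lt_ti odd_ti] := tP i ik.
(* An odd gap other than 1 is at least 3, so the indices [(t i).+1] and [(t i).+2] are not selected
   and a pivot may erase them. *)
have ti3 : t i + 3 <= t i.+1.
  by have := odd_ti; rewrite leq_eqVlt => oe; lia.
have tik := alternating_mono tP ik (leqnn k).
have [pv p_inj pp vp] := apex.
have ain : (t i).+1 < n by lia.
pose t' j := if j <= i then t j else (t j).-2.
have t'E j : j <= k -> skip2 (t i).+1 (t' j) = t j.
  move=> jk; rewrite /t'; case: leqP => ji.
    by rewrite skip2_lt //; have := alternating_mono tP ji (ltnW ik); lia.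
  by have := alternating_mono tP ji jk => ?; rewrite skip2_ge; lia.
have fE j : j <= k -> (f \o skip2 (t i).+1) (t' j) = f (t j).
  by move=> jk; rewrite /= t'E.
have noC' : no_pivot_minor_iso (cycle_graph k) (pivot (p (t i)) (p (t i).+1)).
  by apply: no_pivot_minor_pivot noC; rewrite pp /near ?eqxx // ltnW.
have n2 : n.-2 < n by lia.
apply: (IHn n.-2 n2 (pivot (p (t i)) (p (t i).+1)) v _ _ t' noC'
              (path_apex_pivot apex ain)).
- move=> j jk; have [tj oj] := tP j jk; rewrite /t'.
  have odd2 a : 1 < a -> odd a.-2 = odd a.
    by case: a => [|[|a]] //= _; rewrite negbK.
  case: (ltngtP j i) => ji; first by [].
    have tij := alternating_mono tP ji (ltnW jk).
    have a1 : 1 < t j by clear -ti3 tij; lia.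
    have b1 : 1 < t j.+1 by clear -tj a1; lia.
    by rewrite !odd2 //; split => //; clear -tj a1; lia.
  rewrite ji in tj oj *.
  have b1 : 1 < t i.+1 by clear -ti3; lia.
  by rewrite odd2 //; split => //; clear -ti3; lia.
- rewrite /t' (leqNgt k) ik /=; clear -tn ti3 tik ain; lia.
- by rewrite !fE //; lia.
- by move=> j j0 jk; rewrite !fE; [apply: fi | lia | lia].
- by rewrite !fE //; lia.
Qed.

(** * Runs in binary sequences *)

(* The last [k] terms of an alternating subsequence encoding a hole; the first
   term [t 0] is supplied in [no_tail_run] by one of the indices [0], [2]. *)
Definition tail_run (k : nat) (f : nat -> bool) (t : nat -> nat) :=
  [/\ 1 < t 1,
      forall i, 0 < i < k -> t i < t i.+1 /\ odd (t i.+1) = ~~ odd (t i),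
      forall i, 0 < i -> i.+2 < k -> f (t i) = f (t i.+2)
    & f (t k.-2) != f (t k)].

Lemma const_run (f : nat -> bool) (z l a d : nat) :
  (forall i, z <= i < l -> f i = f i.+2) -> z <= a -> a + d.*2 <= l.+1 ->
  f a = f (a + d.*2).
Proof.
move=> fE za; elim: d => [|d IHd] al; first by rewrite addn0.
rewrite doubleS !addnS in al *.
rewrite IHd; last by rewrite ltnW // ltnW.
by apply: fE; rewrite (leq_trans za (leq_addr _ _)).
Qed.

(** Along the zeros [f] is constant on each parity class, so consecutive indices serve as terms; a
    final jump to [l.+2] gives the only change. *)
Lemma zeros_run (k z l : nat) (f : nat -> bool) :
  2 < k -> z + k <= l -> (forall i, z <= i < l -> f i = f i.+2) ->
  f l != f l.+2 ->
  exists2 t, tail_run k f t & odd (t 1) = odd (l + k.-1) /\ t k = l.+2.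
Proof.
case: k => [|[|[|k]]] // _ zl fE fl.
(* The parity of [a] makes the final jump odd; starting at [z.+2] or later ensures [1 < t 1]. *)
pose a := if odd z == (odd l (+) odd k) then z.+2 else z.+3.
have za : z.+2 <= a <= z.+3 by rewrite /a; case: ifP; rewrite !leqnn leqnSn.
have oa : odd a = odd l (+) odd k.
  by rewrite /a; case: eqP => /=; case: (odd z); case: (odd l); case: (odd k).
exists (fun i => if i < k.+3 then a + i.-1 else l.+2); last first.
  by rewrite ltnn addn0 oa oddD /= negbK.
split.
- by rewrite /= addn0; clear -za; lia.
- move=> i /andP[i0 ik]; rewrite ik; case: (ltnP i.+1 k.+3) => ik' /=.
    by rewrite -(prednK i0) /= addnS /=.
  have -> : i = k.+2 by apply/eqP; rewrite eqn_leq -ltnS ik -ltnS.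
  split; first by clear -za zl; lia.
  by rewrite /= oddD oa /=; case: (odd l); case: (odd k).
- move=> i i0 ik; rewrite ik (ltn_trans _ ik) //.
  have -> : a + i.+2.-1 = a + i.-1 + 1.*2 by clear -i0; lia.
  by apply: (@const_run f z l) => //; clear -za zl ik i0; lia.
rewrite ltnn /= (_ : k.+1 < k.+3) //.
have lak : a + k <= l by clear -za zl; lia.
rewrite (@const_run f z l (a + k) ((l - (a + k))./2)) //; try by clear -za lak; lia.
by rewrite even_halfK ?subnKC // oddB // oddD oa; case: (odd l); case: (odd k).
Qed.

(* Between the terms [i.+1], where [f] is constant, either of the indices [i]
   and [i.+2] is available, so [f] takes there any prescribed value. *)
Lemma ones_run (k c : nat) (f : nat -> bool) (s : seq nat) :
  2 < k -> k < size s -> sorted ltn s ->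
  {in s, forall i, (odd i = odd c) * (f i != f i.+2)} ->
  (exists b, {in s, forall i, f i.+1 = b}) ->
  exists2 t, tail_run k f t
    & odd (t 1) = odd (c + k.-1) /\ (exists2 i, i \in s & t k <= i.+2).
Proof.
move=> k_gt2 ks s_sorted sP [b fb].
have inS i : i <= k -> nth 0 s i \in s.
  by move=> ik; rewrite mem_nth // (leq_ltn_trans ik).
have nS i : i < k -> (nth 0 s i).+2 <= nth 0 s i.+1.
  move=> ik; have lt_n : nth 0 s i < nth 0 s i.+1.
    by apply: (sorted_ltn_nth ltn_trans) => //;
      rewrite inE (leq_ltn_trans _ ks) // ltnW.
  have [oi _] := sP _ (inS i (ltnW ik)); have [oi1 _] := sP _ (inS _ ik).
  rewrite ltn_neqAle lt_n andbT; apply: contra_eq_neq oi1 => <-.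
  by rewrite /= oi; case: (odd c).
(* The prescribed values are 0, except 1 at the last term. Elements of [s] have equal parity, hence
   lie at least 2 apart, which keeps [t] increasing whichever choices are made. *)
pose t i := let x := nth 0 s i in
  if odd (k - i) then x.+1 else if f x == (i == k) then x else x.+2.
have tx i : nth 0 s i <= t i <= (nth 0 s i).+2.
  by rewrite /t; case: ifP => _; last case: ifP => _; clear; lia.
have fE i : i <= k -> f (t i) = if odd (k - i) then b else (i == k).
  move=> ik; rewrite /t; case: ifP => _; first by rewrite fb ?inS.
  case: eqP => // /eqP; have [_] := sP _ (inS i ik).
  by case: (f _) (f _.+2) (i == k) => [] [] [].
have oE i : i <= k -> odd (t i) = odd c (+) odd (k - i).
  move=> ik; have [oi _] := sP _ (inS i ik); rewrite /t.
  case: ifP => _; first by rewrite /= oi addbT.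
  by rewrite addbF; case: ifP => _ //=; rewrite negbK.
exists t; last first.
  split; last by exists (nth 0 s k); rewrite ?inS //; case/andP: (tx k).
  by rewrite oE ?oddD ?subn1 //; clear -k_gt2; lia.
split.
- have/nS : 0 < k by apply: ltn_trans k_gt2.
  by have /andP[+ _] := tx 1; move=> t1 n1; apply: leq_trans t1; apply: leq_trans n1.
- move=> i /andP[i0 ik]; split; last first.
    rewrite (oE i.+1) // (oE i (ltnW ik)) -[k - i]prednK ?subn_gt0 //.
    by rewrite -subnS /= addbN negbK.
  have := nS _ ik; rewrite /t -[k - i]prednK ?subn_gt0 // -subnS /=.
  by case: (odd _) => /=; case: ifP => _ n_lt; clear -n_lt; lia.
- move=> i i0 ik; have ik' := ltnW (ltnW ik).
  rewrite (fE i (ltnW ik')) (fE i.+2 (ltnW ik)).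
  rewrite (_ : k - i = (k - i.+2).+2) /=; last by clear -ik; lia.
  by rewrite negbK !ltn_eqF.
have k2 : k - k.-2 = 2 by clear -k_gt2; lia.
by rewrite !fE ?subnn ?eqxx ?k2 /= ?ltn_eqF //; clear -k_gt2; lia.
Qed.

(** Cut the word into [r] blocks of length [k]: either each of them contains a one, or some block is
    zero. *)
Lemma ones_or_zeros (b : nat -> bool) (k r : nat) :
  r <= count b (iota 0 (r * k)) \/
  exists2 z, z + k <= r * k & forall i, z <= i < z + k -> b i = false.
Proof.
elim: r => [|r [IHr | [z zr b0]]]; first by left.
  have [b1 | b0] := boolP (has b (iota (r * k) k)).
    by left; rewrite mulSnr iotaD count_cat add0n -addn1 leq_add // -has_count.
  right; exists (r * k) => [|i ik]; first by rewrite mulSnr.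
  by apply: contraNF b0 => bi; apply/hasP; exists i; rewrite ?mem_iota.
by right; exists z => //; rewrite (leq_trans zr) // mulSn leq_addl.
Qed.

Lemma count_pigeonhole (T : Type) (P Q : pred T) (s : seq T) (r : nat) :
  r.*2 <= count P s ->
  exists c : bool, r <= count (fun x => P x && (Q x == c)) s.
Proof.
have -> : count P s = count (fun x => P x && (Q x == true)) s
                    + count (fun x => P x && (Q x == false)) s.
  by elim: s => //= x s ->; case: (P x); case: (Q x); rewrite /= ?addn0 ?addnS.
move=> r2; have [r_le|r_gt] := leqP r (count (fun x => P x && (Q x == true)) s).
  by exists true.
by exists false; clear -r2 r_gt; lia.
Qed.

(* The word [b] is followed by the word 0 ... 0 1 of length [m], which depends
   on the apex; only the parity [e] of [m] matters for the parity [o]. *)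
Lemma ex_tail_run (k r n : nat) (b : nat -> bool) (e : bool) :
  2 < k -> r = k.+1.*2.*2 -> n = r * k ->
  exists o : bool, forall (m : nat) (f : nat -> bool),
    odd m = e -> 0 < m ->
    (forall i, i < n -> f i (+) f i.+2 = b i) ->
    (forall i, n <= i < n + m -> f i (+) f i.+2 = (i.+1 == n + m)) ->
    exists2 t, tail_run k f t & odd (t 1) = o /\ t k <= (n + m).+1.
Proof.
move=> k_gt2 rE nE; have [ones | [z zn b0]] := ones_or_zeros b k r.
  rewrite -nE rE in ones.
  (* The parity [c] is chosen from [b] alone, so [o] does not depend on [f]; only the later choice
     of the value [d] does. The factor 4 in [r] pays for both and leaves [k.+1] ones. *)
  have [c {}ones] := count_pigeonhole odd ones.
  exists (odd (c + k.-1)) => m f _ m_gt0 fb _.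
  have [d {}ones] := count_pigeonhole (fun i => f i.+1) ones.
  set P := fun i => _ in ones; pose s := filter P (iota 0 n).
  have sP i : i \in s -> [/\ i < n, b i, odd i = c & f i.+1 = d].
    by rewrite mem_filter mem_iota => /andP[/andP[/andP[bi /eqP oi] /eqP fi] ni].
  have [| | | |t t_run [ot [i /sP[i_n _ _ _] ti]]] := @ones_run k c f s k_gt2.
  - by rewrite size_filter.
  - by apply: (sorted_filter ltn_trans); apply: iota_ltn_sorted.
  - move=> i /sP[i_n bi oi _]; rewrite oddb; split => //.
    by move: (fb _ i_n); rewrite bi; case: (f i) (f i.+2) => [] [].
  - by exists d => i /sP[].
  exists t => //; split=> //; apply: leq_trans ti _.
  by clear -i_n m_gt0; lia.
(* The zero block is continued up to the next one of the whole word, at position [l]: this is a one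
   of [b] or, if none follows, the last letter. *)
have b_run m f l : 0 < m ->
    (forall i, i < n -> f i (+) f i.+2 = b i) ->
    (forall i, n <= i < n + m -> f i (+) f i.+2 = (i.+1 == n + m)) ->
    z + k <= l < n + m -> (l < n -> b l) -> (n <= l -> l.+1 = n + m) ->
    (forall i, z + k <= i < l -> i < n -> b i = false) ->
    exists2 t, tail_run k f t & odd (t 1) = odd (l + k.-1) /\ t k <= (n + m).+1.
  move=> m_gt0 fb fm /andP[zl lm] bl l_last b_l0.
  have [| |t t_run [ot tk]] := @zeros_run k z l f k_gt2 zl.
  - move=> i /andP[zi il]; apply/eqP; rewrite -[_ == _]negbK -negb_add negbK.
    have [i_n|n_i] := ltnP i n.
      rewrite fb //; have [iz|zi'] := ltnP i (z + k); first by rewrite b0 ?zi.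
      by rewrite (b_l0 i) // zi'.
    rewrite fm ?n_i ?(ltn_trans il) //; have nl := l_last (leq_trans n_i (ltnW il)).
    by rewrite -nl eqSS ltn_eqF.
  - apply/eqP => /eqP; rewrite -[_ == _]negbK -negb_add.
    have [/[dup] l_n /bl|/[dup] n_l /l_last lE] := ltnP l n.
      by rewrite fb // => ->.
    by rewrite fm ?n_l // lE eqxx.
  by exists t; rewrite // tk.
rewrite -nE in zn.
have [/hasP[x] | /hasPn b_n0] := boolP (has b (iota (z + k) (n - (z + k)))).
  rewrite mem_iota subnKC // => /andP[zx xn] bx.
  pose P i := b i && (z + k <= i < n).
  have exP : exists i, P i by exists x; rewrite /P bx zx.
  case: (ex_minnP exP) => l /andP[bl /andP[zl ln]] l_min.
  exists (odd (l + k.-1)) => m f om m_gt0 fb fm.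
  apply: (b_run m f l m_gt0 fb fm) => //; first by rewrite zl ltn_addr.
    by rewrite leqNgt ln.
  move=> i /andP[zi il] i_n; apply: contraTF il => bi.
  by rewrite -leqNgt l_min // /P bi zi.
(* Here [l] is [(n + m).-1], so that [l + k.-1] has the parity of [n + m + k]. *)
exists (odd n (+) e (+) odd k) => m f om m_gt0 fb fm.
have nm : (n + m).-1.+1 = n + m by rewrite prednK // addn_gt0 m_gt0 orbT.
have n_le : n <= (n + m).-1 by rewrite -ltnS nm -[n.+1]addn1 leq_add2l.
have [| | | |t t_run [ot tk]] := b_run m f (n + m).-1 m_gt0 fb fm.
- by rewrite (leq_trans zn n_le) nm /=.
- by rewrite ltnNge n_le.
- by rewrite nm.
- by move=> i /andP[zi _] i_n; apply/negbTE/b_n0; rewrite mem_iota zi subnKC.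
exists t; rewrite // ot tk; split=> //.
have k1 : odd k = ~~ odd k.-1 by rewrite -{1}(prednK (ltnW (ltnW k_gt2))).
have nm1 : odd (n + m) = ~~ odd (n + m).-1 by rewrite -{1}nm.
by rewrite oddD k1 addbN -om -(oddD n m) nm1 addNb negbK.
Qed.

(** As [f 0] and [f 2] differ, one of them differs from [f (d + t 2)] and supplies the first term.
    Both indices are even and below the odd index [d + t 1]. *)
Lemma no_tail_run (k n d : nat) (G : sgraph) (v : G) (p : nat -> G)
    (f : nat -> bool) (t : nat -> nat) :
  2 < k -> no_pivot_minor_iso (cycle_graph k) G -> path_apex n v p f ->
  f 0 != f 2 -> 0 < d -> tail_run k (fun i => f (d + i)) t ->
  odd (d + t 1) -> d + t k <= n.+1 -> False.
Proof.
move=> k_gt2 noC apex f02 d_gt0 [t1 t_alt t_const t_last] odd_t1 tk.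
pose a := if f 0 != f (d + t 2) then 0 else 2.
have [fa even_a a2] : [/\ f a != f (d + t 2), odd a = false & a <= 2].
  rewrite /a; case: ifP => // /negbFE/eqP e; split=> //.
  by rewrite -e eq_sym.
pose t' i := if i is 0 then a else d + t i.
have t'E i : 0 < i -> t' i = d + t i by case: i.
apply: (@no_apex_run k n G v p f t' k_gt2 noC apex).
- move=> [|i] ik /=.
    split; first by clear -t1 d_gt0 a2; lia.
    by rewrite odd_t1 even_a.
  have [//|lt_t odd_t] := t_alt i.+1; split; first by rewrite ltn_add2l.
  by rewrite !oddD odd_t addbN.
- by rewrite t'E // ltnW // ltnW.
- exact: fa.
- by move=> i i0 ik; rewrite !t'E // t_const.
- by rewrite !t'E //; clear -k_gt2; lia.
Qed.

(** * Colourings, connectivity and induced paths *)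

Local Notation col S m := (colorable (induced S) m).

Section Sets.
Variable G : sgraph.
Implicit Types (S T C D : {set G}) (x y z u v w : G) (s p q : seq G).

(** Colourings become functions to [nat] on all of [G], which spares the later constructions the
    subtype. *)
Lemma colP S m :
  reflect (exists c : G -> nat,
             {in S, forall x, c x < m} /\
             {in S &, forall x y, adj x y -> c x != c y})
          (col S m).
Proof.
apply: (iffP existsP) => [[c /'forall_'forall_implyP cP] | [c [c_lt cP]]].
  exists (fun x => if insub x is Some y then c y : nat else 0); split.
    by move=> x xS; rewrite insubT.
  by move=> x y xS yS xy; rewrite !insubT; apply: (cP (Sub x xS) (Sub y yS)).
exists [ffun x => Ordinal (c_lt (val x) (valP x))].
apply/'forall_'forall_implyP => x y xy; rewrite !ffunE -val_eqE /=.
exact: cP (valP x) (valP y) xy.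
Qed.

Lemma col_sub S T m n : S \subset T -> m <= n -> col T m -> col S n.
Proof.
move=> /subsetP ST mn /colP[c [c_lt cP]]; apply/colP; exists c; split.
  by move=> x /ST /c_lt cx; apply: leq_trans mn.
by move=> x y /ST xT /ST yT; apply: cP.
Qed.

Lemma col_setU S T m n : col S m -> col T n -> col (S :|: T) (m + n).
Proof.
move=> /colP[c [c_lt cP]] /colP[d [d_lt dP]]; apply/colP.
exists (fun x => if x \in S then c x else m + d x); split=> [x | x y].
  rewrite inE; case: ifP => [xS _ | _ /= xT]; first by rewrite ltn_addr ?c_lt.
  by rewrite ltn_add2l d_lt.
rewrite !inE; case: ifP => xS; case: ifP => yS /= xT yT xy.
- exact: cP.
- by rewrite ltn_eqF // ltn_addr ?c_lt.
- by rewrite gtn_eqF // ltn_addr ?c_lt.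
by rewrite eqn_add2l dP.
Qed.

Lemma col0 m : col (set0 : {set G}) m.
Proof. by apply/colP; exists (fun=> 0); split=> [x | x y]; rewrite inE. Qed.

Definition in_adj S : rel G := [rel x y | [&& x \in S, y \in S & adj x y]].

Definition conn S := {in S &, forall x y, connect (in_adj S) x y}.

Lemma in_adj_sym S : symmetric (in_adj S).
Proof. by move=> x y; rewrite /in_adj /= adj_sym andbCA. Qed.

Lemma connect_exit (e : rel G) T x y :
  connect e x y -> x \in T -> y \notin T ->
  exists a b, [/\ connect e x a, e a b, a \in T & b \notin T].
Proof.
move=> /connectP[p]; elim: p x => [|z p IHp] x /=; first by move=> _ -> ->.
move=> /andP[xz zp] yE xT yT; have [zT|zT] := boolP (z \in T); last by exists x, z.
have [a [b [za ab aT bT]]] := IHp z zp yE zT yT.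
by exists a, b; split=> //; apply: connect_trans za; apply: connect1.
Qed.

Lemma conn_cut C T x y :
  conn C -> x \in C -> y \in C -> x \in T -> y \notin T ->
  exists a b, [/\ a \in C, b \in C, adj a b, a \in T & b \notin T].
Proof.
move=> cC xC yC xT yT.
have [a [b [_ /and3P[aC bC ab] aT bT]]] := connect_exit (cC x y xC yC) xT yT.
by exists a, b.
Qed.

(** No edge joins different components, so colourings of all of them, selected through the root of
    each vertex, would combine into one of [S]. *)
Lemma component S m :
  ~~ col S m ->
  exists D, [/\ D \subset S, conn D, ~~ col D m
    & forall x y, x \in D -> y \in S -> adj x y -> y \in D].
Proof.
pose K x := [set y in S | connect (in_adj S) x y].
have sym_S := sym_connect_sym (@in_adj_sym S).
have [/forallP K_col | /forallPn[x nK] _] := boolP [forall x, col (K x) m].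
  have /fin_all_exists[c cP] := fun x => elimT (colP _ _) (K_col x).
  case/negP.
  pose r := root (in_adj S).
  have Kr x : x \in S -> x \in K (r x) by move=> xS; rewrite inE xS sym_S connect_root.
  apply/colP; exists (fun x => c (r x) x); split=> [x xS | x y xS yS xy].
    by have [c_lt _] := cP (r x); apply/c_lt/Kr.
  have rE : r x = r y.
    by apply/(rootP sym_S)/connect1; rewrite /in_adj /= xS yS.
  have [_ c_adj] := cP (r x).
  by rewrite -rE; apply: c_adj => //; [exact: Kr | rewrite rE; exact: Kr].
exists (K x); split=> //; first by apply/subsetP => y; rewrite inE => /andP[].
  move=> y z yK zK; move: (yK) (zK); rewrite !inE => /andP[yS xy] /andP[zS xz].
  have yz : connect (in_adj S) y z by rewrite (connect_trans _ xz) // sym_S.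
  (* A walk in [S] from [y] stays in [K x]: a first step out of [T] would still be an edge inside
     [K x]. *)
  pose T := [set a | connect (in_adj (K x)) y a].
  have yT : y \in T by rewrite inE connect0.
  have [|zT] := boolP (z \in T); first by rewrite inE.
  have [a [b [ya ab aT bT]]] := connect_exit yz yT zT.
  case/negP: bT; move: aT; rewrite !inE => ya'; apply: connect_trans ya' _.
  have xa := connect_trans xy ya; have xb := connect_trans xa (connect1 ab).
  by case/and3P: ab => aS bS ab; apply: connect1; rewrite /in_adj /= !inE aS bS xa xb.
move=> y z; rewrite !inE => /andP[yS xy] zS yz; rewrite zS.
by apply: connect_trans xy _; apply: connect1; rewrite /in_adj /= yS zS.
Qed.

Fixpoint ipath s :=
  if s is x :: s' then
    [&& x \notin s',
        (if s' is y :: s'' then adj x y && all (fun z => ~~ adj x z) s'' else true)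
      & ipath s']
  else true.

Lemma ipath_cons x y s :
  ipath (y :: s) -> adj x y -> x \notin y :: s -> {in s, forall z, ~~ adj x z} ->
  ipath (x :: y :: s).
Proof.
move=> ip xy xs x_anti; rewrite -[ipath (x :: _)]/([&& _, _ & ipath (y :: s)]).
by rewrite xs xy ip andbT; apply/allP.
Qed.

Lemma ipath_uniq s : ipath s -> uniq s.
Proof. by elim: s => //= x s IHs /and3P[-> _ /IHs]. Qed.

Lemma ipath_near s x0 i j :
  ipath s -> i < size s -> j < size s -> adj (nth x0 s i) (nth x0 s j) = near i j.
Proof.
have head_adj x s' n : ipath (x :: s') -> n < size s' -> adj x (nth x0 s' n) = (n == 0).
  case: s' => [|y s'] //= /and3P[_ /andP[xy xs'] _].
  by case: n => [|n] //= ns'; apply/negbTE/(allP xs'); rewrite mem_nth.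
elim: s i j => [|x s IHs] [|i] [|j] // xs is_ js.
- by rewrite /= adj_irrefl.
- by rewrite /= head_adj // /near orbF eqSS eq_sym.
- by rewrite /= adj_sym head_adj // /near orFb eqSS eq_sym.
by rewrite /= IHs /near ?eqSS //; case/and3P: xs.
Qed.

Lemma ipath_cat s a q :
  ipath (rcons s a) -> ipath (a :: q) ->
  {in s & q, forall u v, (u != v) && ~~ adj u v} -> ipath (s ++ a :: q).
Proof.
move=> + aq; elim: s => [|x s IHs] // xs sq.
have {xs} /and3P[x_s xy ipath_s] : ipath (x :: rcons s a) by [].
have xq v : v \in q -> (x != v) && ~~ adj x v by apply: sq; rewrite mem_head.
have x_q : x \notin q by apply/negP => /xq; rewrite eqxx.
have all_q : all (fun z => ~~ adj x z) q by apply/allP => v /xq/andP[].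
rewrite cat_cons /=; apply/and3P; split.
- by rewrite -cat_rcons mem_cat negb_or x_s x_q.
- case: s xy {IHs x_s ipath_s sq} => [|y s] /=; first by move/andP => [-> _].
  by case/andP=> -> /=; rewrite all_cat all_rcons /= => /andP[-> ->].
by apply: IHs => // u v us vq; apply: sq; rewrite // inE us orbT.
Qed.

(* The path is listed from its end [x] towards its origin. *)
Definition reaches x s C :=
  [/\ ipath (x :: s), {in x :: s, forall u, u \notin C},
      {in s & C, forall u c, ~~ adj u c}, conn C & exists2 c, c \in C & adj x c].

Lemma reaches_cons x s C y D :
  reaches x s C -> y \in C -> adj x y -> y \notin D -> D \subset C -> conn D ->
  {in D, forall d, ~~ adj x d} -> (exists2 d, d \in D & adj y d) ->
  reaches y (x :: s) D.
Proof.
move=> [ip sC s_anti _ _] yC xy yD /subsetP DC cD x_anti yd; split=> //.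
- apply: ipath_cons => //; first by rewrite adj_sym.
    by apply/negP => /sC; rewrite yC.
  by move=> z zs; rewrite adj_sym s_anti.
- by move=> u; rewrite inE => /predU1P[-> // | /sC]; apply: contra => /DC.
- move=> u d; rewrite inE => /predU1P[-> | us] dD; [exact: x_anti |].
  by apply: s_anti => //; apply: DC.
Qed.

Lemma reaches_step x s C c m :
  reaches x s C -> col [set y in C | adj x y] c -> ~~ col C (m + c) ->
  exists y D, [/\ y \in C, D \subset C, reaches y (x :: s) D & ~~ col D m].
Proof.
move=> xsC Nc nC; have [_ _ _ cC [y0 y0C xy0]] := xsC.
pose R := [set y in C | ~~ adj x y].
have nR : ~~ col R m.
  apply: contra nC => Rm; have := col_setU Rm Nc; congr (col _ _).
  by apply/setP => y; rewrite !inE; case: (y \in C); case: (adj x y).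
have [D [/subsetP DR cD nD D_closed]] := component nR.
have DC y : y \in D -> y \in C by move/DR; rewrite inE => /andP[].
have xD : {in D, forall d, ~~ adj x d} by move=> d /DR; rewrite inE => /andP[].
have [D0|[d0 d0D]] := set_0Vmem D; first by rewrite D0 col0 in nD.
have y0D : y0 \notin D by apply/negP => /xD; rewrite xy0.
have [a [b [_ bC ab aD bD]]] := conn_cut cC (DC _ d0D) y0C d0D y0D.
have xb : adj x b.
  by apply: contraNT bD => xb; apply: D_closed ab => //; rewrite inE bC.
have DsC : D \subset C by apply/subsetP.
exists b, D; split=> //; apply: (reaches_cons xsC) => //.
by exists a; rewrite // adj_sym.
Qed.

Lemma reaches_grow n x s C c m :
  reaches x s C -> {in x :: s, forall u, col [set y in C | adj u y] c} ->
  {in C, forall u, col [set y in C | adj u y] c} -> ~~ col C (m + n * c) ->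
  exists y q p D,
    [/\ y :: q = p ++ x :: s, size p = n, {subset p <= C}, D \subset C
       & reaches y q D /\ ~~ col D m].
Proof.
elim: n x s C => [|n IHn] x s C xsC Ns NC nC.
  by exists x, s, [::], C; split; rewrite // addn0 in nC *.
rewrite mulSnr addnA in nC.
have [y [D [yC /subsetP DC ysD nD]]] := reaches_step xsC (Ns x (mem_head _ _)) nC.
have N_sub u : col [set y in C | adj u y] c -> col [set y in D | adj u y] c.
  apply: col_sub => //; apply/subsetP => z; rewrite !inE => /andP[/DC ->].
  by [].
have [| |z [q [p [E [zq pn pD ED zqE]]]]] := IHn y (x :: s) D ysD _ _ nD.
- by move=> u; rewrite inE => /predU1P[-> | us]; apply: N_sub; [apply: NC | apply: Ns].
- by move=> u /DC uC; apply/N_sub/NC.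
exists z, q, (rcons p y), E; split=> //; first by rewrite cat_rcons.
- by rewrite size_rcons pn.
- by move=> u; rewrite mem_rcons inE => /predU1P[-> // | /pD/DC].
by apply: subset_trans ED _; apply/subsetP.
Qed.

(** The target [D] need not be connected: in [ipath_link] it is the set of neighbours of a
    vertex. *)
Lemma ipath_approach x s C D :
  ipath (x :: s) -> {in x :: s, forall u, u \notin C} ->
  {in s & C, forall u c, ~~ adj u c} -> conn C -> (exists2 c, c \in C & adj x c) ->
  D \subset C -> D != set0 ->
  exists y q p, [/\ y :: q = p ++ x :: s, {subset p <= C}, ipath (y :: q),
    {in y :: q, forall u, u \notin D} &
    {in q & D, forall u d, ~~ adj u d} /\ exists2 d, d \in D & adj y d].
Proof.
move=> ip sC s_anti cC [c0 c0C xc0].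
(* If [x] has no neighbour in [D], first approach [D] enlarged by its
   neighbours in [C]. *)
elim: {D}_.+1 {-2}D (ltnSn #|C :\: D|) => // n IHn D Dn DC D0.
have [/exists_inP[d dD xd]|no_xd] := boolP [exists d in D, adj x d].
  exists x, s, [::]; split=> //.
    by move=> u /sC; apply/contra/(subsetP DC).
  by split; [move=> u e us /(subsetP DC); apply: s_anti | exists d].
have {}no_xd d : d \in D -> ~~ adj x d.
  by move=> dD; apply: contra no_xd => xd; apply/exists_inP; exists d.
have c0D : c0 \notin D by apply/negP => /no_xd; rewrite xc0.
have [d0 d0D] := set0Pn _ D0.
have [a [b [aC bC ab aD bD]]] := conn_cut cC (subsetP DC _ d0D) c0C d0D c0D.
pose D' := D :|: [set c in C | [exists d in D, adj c d]].
have D'C : D' \subset C.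
  by rewrite subUset DC; apply/subsetP => c; rewrite inE => /andP[].
have DD' : D \subset D' by apply: subsetUl.
have bD' : b \in D'.
  by rewrite !inE bC; apply/orP; right; apply/exists_inP; exists a; rewrite // adj_sym.
have lt_D' : #|C :\: D'| < n.
  rewrite ltnS in Dn; apply: leq_trans Dn; apply/proper_card/properP; split.
    exact: setDS.
  by exists b; rewrite !in_setD ?bD' ?bC ?bD.
have D'0 : D' != set0 by apply/set0Pn; exists b.
have [y [q [p [E pC ipy yqD' [qD' [d dD' yd]]]]]] := IHn D' lt_D' D'C D'0.
have yqD u : u \in y :: q -> u \notin D by move/yqD'; apply/contra/(subsetP DD').
have [/exists_inP[e eD ye]|no_yd] := boolP [exists e in D, adj y e].
  exists y, q, p; split=> //; split; last by exists e.
  by move=> u z uq /(subsetP DD'); apply: qD'.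
have {}no_yd e : e \in D -> ~~ adj y e.
  by move=> eD; apply: contra no_yd => ye; apply/exists_inP; exists e.
have dD : d \notin D by apply/negP => /no_yd; rewrite yd.
move: (dD'); rewrite !inE (negPf dD) /= => /andP[dC /exists_inP[e eD de]].
exists d, (y :: q), (d :: p); split.
- by rewrite E.
- by move=> u; rewrite inE => /predU1P[-> | /pC].
- apply: ipath_cons => //; first by rewrite adj_sym.
    by apply/negP => /yqD'; rewrite dD'.
  by move=> u uq; rewrite adj_sym qD'.
- by move=> u; rewrite inE => /predU1P[-> // | /yqD].
split; last by exists e.
move=> u z; rewrite inE => /predU1P[-> | uq] zD; first exact: no_yd.
by apply: qD' => //; apply: (subsetP DD').
Qed.

Lemma reaches_approach x s C D :
  reaches x s C -> D \subset C -> conn D -> D != set0 ->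
  exists y q p, [/\ y :: q = p ++ x :: s, {subset p <= C} & reaches y q D].
Proof.
move=> [ip sC s_anti cC xc] DC cD D0.
have [y [q [p [E pC ipy yqD [qD yd]]]]] := ipath_approach ip sC s_anti cC xc DC D0.
by exists y, q, p.
Qed.

(** Approach the neighbours of [u] in [A] from [w]. The path stops at its first vertex among them,
    the only one that [u] sees. *)
Lemma ipath_link A u w :
  conn A -> u \notin A -> w \notin A -> u != w ->
  (exists2 a, a \in A & adj u a) -> (exists2 a, a \in A & adj w a) ->
  exists2 q, {subset q <= A} & ipath (u :: rcons q w).
Proof.
move=> cA uA wA uw [a aA ua] wa.
have [adj_uw|n_uw] := boolP (adj u w).
  by exists [::]; rewrite //= adj_uw inE uw.
pose D := [set a in A | adj u a].
have DA : D \subset A by apply/subsetP => d; rewrite inE => /andP[].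
have D0 : D != set0 by apply/set0Pn; exists a; rewrite inE aA.
have [|||y [q [p [E pA ip yqD [qD [d dD yd]]]]]] :=
  @ipath_approach w [::] A D _ _ _ cA wa DA D0; try by [].
  by move=> v; rewrite inE => /eqP ->.
have [dA ud] : d \in A /\ adj u d by apply/andP; move: dD; rewrite inE.
exists (d :: p) => [v|]; first by rewrite inE => /predU1P[-> | /pA].
rewrite /= -cats1 -E.
have u_yq v : v \in y :: q -> (u != v) && ~~ adj u v.
  move=> v_yq; move: (v_yq) (yqD v v_yq).
  rewrite E mem_cat inE => /orP[/pA vA | /eqP ->]; last by rewrite uw n_uw.
  rewrite inE vA /= => ->; rewrite andbT.
  by apply: contraNneq uA => ->.
apply: ipath_cons => //.
- apply: ipath_cons => //; first by rewrite adj_sym.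
    by apply/negP => /yqD; rewrite dD.
  by move=> v vq; rewrite adj_sym qD.
- rewrite inE negb_or; apply/andP; split; first by apply: contraNneq uA => ->.
  by apply/negP => /u_yq; rewrite eqxx.
by move=> v /u_yq/andP[].
Qed.

End Sets.

(** * Levelled graphs *)

(** The solution of [f i (+) f i.+2 = g i] with [f 0] and [f 1] zero; thus every adjacency word has
    an encoding. *)
Fixpoint second_sum (g : nat -> bool) i :=
  if i is i'.+2 then second_sum g i' (+) g i' else false.

Section Layers.
Variable G : sgraph.
Implicit Types (S T C D : {set G}) (x y z u v w : G) (s p q : seq G).

(** The tail run is sought behind [z :: p], with offset [(size p).+1]. Hence the adjacencies of [w]
    to [p] are irrelevant and only the parity of [size p] matters. *)
Lemma no_layered_path k z p s u q w (o : bool) :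
  2 < k -> no_pivot_minor_iso (cycle_graph k) G ->
  ipath (z :: p ++ s ++ u :: q) -> w \notin z :: p ++ s ++ u :: q -> adj w z ->
  ipath (u :: rcons q w) ->
  (forall f : nat -> bool,
     (forall i, i < size s -> f i (+) f i.+2 = adj w (nth u s i)) ->
     (forall i, size s <= i < size s + (size q).+1 ->
        f i (+) f i.+2 = (i.+1 == size s + (size q).+1)) ->
     exists2 t, tail_run k f t
       & odd (t 1) = o /\ t k <= (size s + (size q).+1).+1) ->
  odd (size p) = o -> False.
Proof.
set L := z :: _; move=> k_gt2 noC ipL wL wz ipq run_ex odd_p.
pose g i := adj w (nth u L i); pose f := second_sum g.
have fE i : f i (+) f i.+2 = g i by rewrite /= addKb.
have sizeL : size L = (size p).+1 + (size s + (size q).+1).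
  by rewrite /L /= !size_cat.
have nthL i : nth u L ((size p).+1 + i) = nth u (s ++ u :: q) i.
  by rewrite /L /= nth_cat ltnNge leq_addr /= addKn.
have [i si|i /andP[si iq]|t t_run [ot tk]] :=
  run_ex (fun i => f ((size p).+1 + i)).
- by rewrite !addnS fE /g nthL nth_cat si.
- rewrite !addnS fE /g nthL nth_cat ltnNge si /=.
  have lt_iq : i - size s < size (u :: q) by rewrite /= ltn_subLR.
  (* Reading [w] as the end of the induced path [u :: rcons q w] shows that its word on [u :: q] is
     0 ... 0 1. *)
  have nth_w : nth u (rcons (u :: q) w) (size (u :: q)) = w.
    by rewrite nth_rcons ltnn eqxx.
  have nth_i : nth u (rcons (u :: q) w) (i - size s) = nth u (u :: q) (i - size s).
    by rewrite nth_rcons lt_iq.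
  rewrite -nth_i -{1}nth_w adj_sym (@ipath_near G (rcons (u :: q) w)) ?size_rcons //.
    rewrite /near /= -subSn // [X in _ || X](_ : _ = false) ?orbF.
      by apply/eqP/eqP; clear -si; lia.
    by apply/eqP; move: lt_iq => /=; clear; lia.
  by rewrite ltnW.
apply: (@no_tail_run k (size L) (size p).+1 G w (nth u L) f t) => //.
- split=> [i iL | i j iL jL e | i j iL jL | i iL].
  + by apply: contraNneq wL => <-; apply: mem_nth.
  + by apply/eqP; rewrite -(nth_uniq u iL jL (ipath_uniq ipL)) e.
  + exact: ipath_near.
  + by rewrite fE.
- by rewrite /f /= /g /L /= wz.
- by rewrite oddD ot /= odd_p; case: (o).
by rewrite sizeL -addnS leq_add2l.
Qed.

Lemma ipath_catl s q : ipath (s ++ q) -> ipath s.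
Proof.
elim: s => [|x s IHs] // /and3P[xs x_adj /IHs ip].
apply/and3P; split=> //; first by move: xs; rewrite mem_cat negb_or => /andP[].
case: s {xs ip IHs} x_adj => //= y s /andP[-> /=].
by rewrite all_cat => /andP[].
Qed.

Lemma col_pigeonhole l m (tr : G -> seq bool) C :
  {in C, forall x, size (tr x) = l} -> ~~ col C (2 ^ l * m) ->
  exists D, [/\ D \subset C, ~~ col D m & {in D &, forall x y, tr x = tr y}].
Proof.
elim: l tr C => [|l IHl] tr C trC nC.
  exists C; rewrite mul1n in nC; split=> // x y /trC/size0nil -> /trC/size0nil ->.
  by [].
pose K b := [set x in C | head false (tr x) == b].
have [b nK] : exists b, ~~ col (K b) (2 ^ l * m).
  have [K1|] := boolP (col (K true) (2 ^ l * m)); last by exists true.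
  have [K0|] := boolP (col (K false) (2 ^ l * m)); last by exists false.
  case/negP: nC; have := col_setU K1 K0; rewrite addnn -mul2n mulnA -expnS.
  apply: col_sub => //; apply/subsetP => x xC.
  by rewrite !inE xC; case: (head _ _).
have [|D [DK nD trD]] := IHl (behead \o tr) (K b) _ nK.
  by move=> x; rewrite inE => /andP[/trC xl _]; rewrite /= size_behead xl.
have xK x : x \in D -> (x \in C) && (head false (tr x) == b).
  by move/(subsetP DK); rewrite inE.
exists D; split=> //; first by apply/subsetP => x /xK/andP[].
move=> x y xD yD; have := trD x y xD yD.
move: (xK x xD) (xK y yD) => /andP[/trC + /eqP +] /andP[/trC + /eqP] /=.
by case: (tr x) (tr y) => [|a s] [|a' s'] //= _ -> _ -> ->.
Qed.

Definition word_bound k := k.+1.*2.*2 * k.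

(** The last summand pays for growing the path by [word_bound k] vertices, the power of 2 for fixing
    the adjacencies to them and one parity; a set that is not [c]-colourable remains. *)
Definition layer_bound k c := 2 ^ (word_bound k).+1 * c + word_bound k * c.

Lemma layered_col k c (A U X : {set G}) :
  2 < k -> no_pivot_minor_iso (cycle_graph k) G ->
  conn A -> [disjoint A & U] -> [disjoint A & X] -> [disjoint U & X] ->
  {in A & X, forall a x, ~~ adj a x} ->
  {in U, forall u, exists2 a, a \in A & adj u a} ->
  {in X, forall x, exists2 u, u \in U & adj u x} ->
  {in U :|: X, forall v, col [set x in X | adj v x] c} ->
  col X (layer_bound k c).
Proof.
move=> k_gt2 noC cA dAU dAX dUX AX_anti UA XU N_col; apply: contraT => nX; exfalso.
have notX : {in U, forall u, u \notin X} by move=> u uU; rewrite (disjointFr dUX).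
have notA : {in U, forall u, u \notin A} by move=> u uU; rewrite (disjointFl dAU).
have [C0 [/subsetP C0X cC0 nC0 _]] := component nX.
have N0 v C : {subset C <= X} -> v \in U :|: X -> col [set x in C | adj v x] c.
  move=> CX /N_col; apply: col_sub => //; apply/subsetP => x; rewrite !inE.
  by case/andP=> /CX -> ->.
have [C00|[x0 x0C0]] := set_0Vmem C0; first by rewrite C00 col0 in nC0.
have [u uU ux0] := XU _ (C0X _ x0C0).
have u_C0 : reaches u [::] C0.
  split=> //; last by exists x0.
  by move=> v; rewrite inE => /eqP ->; apply: contra (notX u uU) => /C0X.
have [||y [q [p [C [yq size_p pC0 /subsetP CC0 [yqC nC]]]]]] :=
    reaches_grow u_C0 _ _ nC0.
- by move=> v; rewrite inE => /eqP ->; apply: N0; rewrite // inE uU.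
- by move=> v /C0X vX; apply: N0; rewrite // inE vX orbT.
(* As [p] is nonempty, [u] is no longer the end of the path; so the vertex [w] chosen below for [x]
   differs from [u]. *)
have uC : {in C, forall x, ~~ adj u x}.
  have [_ _ q_anti _ _] := yqC; move=> x xC; apply: q_anti => //.
  case: p yq size_p {pC0} => [_|y' p [_ ->] _]; last by rewrite mem_cat mem_head orbT.
  by case: (k) k_gt2.
have link x : exists wq : G * seq G, x \in C ->
    [/\ wq.1 \in U, adj wq.1 x, {subset wq.2 <= A} & ipath (u :: rcons wq.2 wq.1)].
  have [xC|_] := boolP (x \in C); last by exists (x, [::]).
  have [w wU wx] := XU _ (C0X _ (CC0 _ xC)).
  have uw : u != w by apply: contraNneq (uC x xC) => ->.
  have [c' c'A ip] := ipath_link cA (notA u uU) (notA w wU) uw (UA u uU) (UA w wU).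
  by exists (w, c').
have {link}[F FP] := fin_all_exists link.
pose tr x := odd (size (F x).2).+1 :: map (adj (F x).1) p.
have [|D [/subsetP DC nD trD]] := @col_pigeonhole _ c tr C _ nC.
  by move=> x _; rewrite /= size_map size_p.
have [E [/subsetP ED cE nE _]] := component nD.
have E0 : E != set0 by apply: contraNneq nE => ->; apply: col0.
have EC : {subset E <= C} by move=> x /ED/DC.
have [y' [q' [p' [y'q' p'C y'E]]]] : exists y q1 p1,
    [/\ y :: q1 = p1 ++ p ++ [:: u], {subset p1 <= C} & reaches y q1 E].
  by rewrite -yq; apply: reaches_approach yqC _ cE E0; apply/subsetP.
have [ip' _ q'E _ [z1 z1E y'z1]] := y'E.
have y'UX : y' \in U :|: X.
  have : y' \in p' ++ p ++ [:: u] by rewrite -y'q' mem_head.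
  rewrite !mem_cat !inE => /or3P[/p'C/CC0/C0X -> | /pC0/C0X -> | /eqP ->];
    by rewrite ?uU ?orbT.
have EX : {subset E <= X} by move=> x /EC/CC0/C0X.
have [z2 z2E y'z2] : exists2 z2, z2 \in E & ~~ adj y' z2.
  apply/exists_inP; apply: contraNT nE; rewrite negb_exists_in => /forall_inP allE.
  apply: col_sub (N0 y' E EX y'UX) => //; apply/subsetP => x xE.
  by rewrite inE xE; apply: negbNE; apply: allE.
(* The neighbours of [y'] in [E] are [c]-colourable and [E] is not, so some edge of [E] has just one
   end seen by [y']. The path can then end at [a] or, one step further, at [b], which offers both
   parities. *)
have [a [b [aE bE ab]]] : exists a b,
    [/\ a \in E, b \in E, adj a b, a \in [set z | adj y' z]
       & b \notin [set z | adj y' z]].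
  by apply: (conn_cut cE z1E z2E); rewrite inE.
rewrite !inE => y'a y'b.
have y'q'E x : x \in E -> x \notin y' :: q'.
  by have [_ y'q'E _ _ _] := y'E; move=> xE; apply/negP => /y'q'E; rewrite xE.
have ipa : ipath (a :: p' ++ p ++ [:: u]).
  rewrite -y'q'; apply: ipath_cons => //; [by rewrite adj_sym | exact: y'q'E |].
  by move=> v vq; rewrite adj_sym q'E.
have ipb : ipath (b :: (a :: p') ++ p ++ [:: u]).
  rewrite cat_cons; apply: ipath_cons; rewrite // -?y'q' 1?adj_sym //.
    rewrite inE negb_or y'q'E // andbT.
    by apply: contraTneq ab => ->; rewrite adj_irrefl.
  by move=> v; rewrite inE => /predU1P[->|vq]; rewrite adj_sym // q'E.
(* The word and the parity are read off at [a], but all of [E] shares them, so the same [o] serves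
   for [b]. *)
have [o oP] := @ex_tail_run k _ (size p) (fun i => adj (F a).1 (nth u p i))
                 (odd (size (F a).2).+1) k_gt2 erefl size_p.
have no_end z pre : z \in E -> {subset pre <= C0} ->
    ipath (z :: pre ++ p ++ [:: u]) -> odd (size pre) = o -> False.
  move=> zE preC0 ipz odd_pre; have [wU wz qA ipq] := FP z (EC z zE).
  have [odd_m trace] : odd (size (F z).2).+1 = odd (size (F a).2).+1
      /\ map (adj (F z).1) p = map (adj (F a).1) p.
    by case: (trD z a (ED z zE) (ED a aE)).
  have pathX v : v \in z :: pre ++ p -> v \in X.
    rewrite inE mem_cat => /or3P[/eqP -> | /preC0/C0X | /pC0/C0X] //.
    exact: EX.
  apply: (@no_layered_path k z pre p u (F z).2 (F z).1 o) => //.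
  - have -> : z :: pre ++ p ++ u :: (F z).2 = (z :: pre ++ p) ++ u :: (F z).2.
      by rewrite /= catA.
    apply: ipath_cat.
    + by move: ipz; rewrite -cats1 /= catA.
    + by apply: (@ipath_catl _ [:: (F z).1]); rewrite cats1.
    move=> v v' /pathX vX /qA v'A; rewrite adj_sym AX_anti // andbT.
    by apply: contraTneq v'A => <-; rewrite (disjointFl dAX).
  - have -> : z :: pre ++ p ++ u :: (F z).2 = (z :: pre ++ p) ++ u :: (F z).2.
      by rewrite /= catA.
    rewrite mem_cat negb_or; apply/andP; split.
      by apply: contra (notX _ wU) => /pathX.
    rewrite inE negb_or; apply/andP; split.
      have := ipath_uniq ipq; rewrite /= mem_rcons inE negb_or eq_sym.
      by case/andP=> /andP[].
    by apply: contra (notA _ wU) => /qA.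
  move=> f fp fq; apply: oP => // i ip.
  rewrite fp // -(nth_map u false) // -[RHS](nth_map u false (adj _)) //.
  by rewrite trace.
have [odd_p'|odd_p'] := eqVneq (odd (size p')) o.
  by apply: no_end ipa odd_p'; rewrite // => v /p'C/CC0.
apply: no_end ipb _ => //; last by move: odd_p'; rewrite /=; case: (odd _); case: (o).
by move=> v; rewrite inE => /predU1P[-> | /p'C/CC0 //]; apply/CC0/EC.
Qed.

End Layers.

(** * Breadth-first layers *)

Section Balls.
Variable G : sgraph.
Implicit Types (S T C D : {set G}) (x y z u v w : G) (s p q : seq G).

Section Ball.
Variables (D : {set G}) (z : G).
Hypothesis zD : z \in D.

(** The radius is shifted by one: [ball 0] is empty and [ball 1] is the centre alone, so the
    differences of successive balls are all the layers. *)
Fixpoint ball j :=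
  if j is j'.+1 then
    z |: (ball j' :|: [set y in D | [exists x in ball j', adj x y]])
  else set0.

Lemma ball_subS j : ball j \subset ball j.+1.
Proof. by apply/subsetP => x /=; rewrite !inE => ->; rewrite orbT. Qed.

Lemma ball_center j : z \in ball j.+1.
Proof. by rewrite /= !inE eqxx. Qed.

Lemma ball_adj j x y : x \in ball j -> y \in D -> adj x y -> y \in ball j.+1.
Proof.
move=> xB yD xy; rewrite /= !inE yD; apply/or3P/Or33.
by apply/exists_inP; exists x.
Qed.

Lemma ball_sub j : ball j \subset D.
Proof.
elim: j => [|j IHj] /=; first exact: sub0set.
apply/subsetP => x; rewrite !inE => /or3P[/eqP -> // | | /andP[] //].
exact: (subsetP IHj).
Qed.

Lemma ball_layer j y :
  y \in ball j.+2 -> y \notin ball j.+1 ->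
  exists2 x, x \in ball j.+1 :\: ball j & adj x y.
Proof.
move=> + yB; rewrite /= !inE.
case/or3P=> [/eqP yz | yB' | /andP[yD /exists_inP[x xB xy]]].
- by rewrite yz ball_center in yB.
- by move: yB; rewrite /= !inE yB'.
exists x => //; rewrite inE xB andbT.
by apply: contra yB => xB'; apply: ball_adj xy.
Qed.

Lemma conn_ball j : conn (ball j).
Proof.
suff from_z x : x \in ball j -> connect (in_adj (ball j)) z x.
  move=> x y xB yB; apply: connect_trans (from_z y yB).
  by rewrite (sym_connect_sym (@in_adj_sym _ (ball j))) from_z.
elim: j x => [|j IHj] x; first by rewrite inE.
have mono a b : connect (in_adj (ball j)) a b -> connect (in_adj (ball j.+1)) a b.
  apply: connect_sub => {}a {}b /and3P[aB bB ab]; apply: connect1.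
  by apply/and3P; split=> //; apply: (subsetP (ball_subS j)).
move=> xB; move: (xB); rewrite [ball _]/= !inE.
case/or3P=> [/eqP -> | /IHj/mono // | /andP[_ /exists_inP[y yB yx]]].
  exact: connect0.
apply: connect_trans (mono _ _ (IHj y yB)) (connect1 _).
by apply/and3P; split=> //; apply: (subsetP (ball_subS j)).
Qed.

Lemma ball_full : conn D -> exists j, ball j = D.
Proof.
move=> cD; suff ball_card j : (j <= #|ball j|) || (D \subset ball j).
  exists #|D|.+1; apply/eqP; rewrite eqEsubset ball_sub /=.
  case/orP: (ball_card #|D|.+1) => // lt_D.
  by have := leq_trans lt_D (subset_leq_card (ball_sub _)); rewrite ltnn.
elim: j => [|j /orP[IHj | DB]] //; last first.
  by rewrite (subset_trans DB (ball_subS j)) orbT.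
have [DB | /subsetPn[y yD yB]] := boolP (D \subset ball j.+1).
  by rewrite orbT.
rewrite orbF; case: j IHj yB => [|j] IHj yB.
  by apply/card_gt0P; exists z; apply: ball_center.
apply: leq_ltn_trans IHj (proper_card _).
have yB' : y \notin ball j.+1 by apply: contra yB; apply: (subsetP (ball_subS _)).
have [a [b [_ bD ab aB bB]]] := conn_cut cD zD yD (ball_center j) yB'.
apply/properP; split; first exact: ball_subS.
by exists b; rewrite // (ball_adj aB).
Qed.

(** Edges stay within a layer or join consecutive layers, so two palettes of [m] colours used
    alternately suffice. The induction records only the palette of the outermost layer, the only one
    adjacent to the next. *)
Lemma col_layers m :
  conn D -> (forall j, col (ball j.+1 :\: ball j) m) -> col D m.*2.
Proof.
move=> cD layer_col; have [j <-] := ball_full cD; apply/colP.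
suff [c [c_lt cP _]] : exists c : G -> nat,
    [/\ {in ball j, forall x, c x < m.*2},
        {in ball j &, forall x y, adj x y -> c x != c y} &
        {in ball j :\: ball j.-1, forall x, (m <= c x) = odd j}] by exists c.
elim: j => [|j [c [c_lt cP c_par]]].
  by exists (fun=> 0); split=> [x|x y|x]; rewrite ?inE.
have /colP[d [d_lt dP]] := layer_col j.
pose c' x := if x \in ball j then c x else odd j.+1 * m + d x.
have dB x : x \in ball j.+1 -> x \notin ball j -> d x < m.
  by move=> xB xB'; apply: d_lt; rewrite inE xB xB'.
have c'_par x : x \in ball j.+1 -> x \notin ball j -> (m <= c' x) = odd j.+1.
  move=> xB xB'; rewrite /c' (negPf xB').
  case: (odd _); rewrite /= ?mul1n ?leq_addr //.
  by rewrite leqNgt dB.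
have cross x y : x \in ball j -> y \in ball j.+1 -> y \notin ball j -> adj x y ->
    c' x != c' y.
  move=> xB yB yB' xy; have xB' : x \notin ball j.-1.
    apply: contra yB' => xB'; have yD : y \in D := subsetP (ball_sub _) y yB.
    by case: (j) xB' => [|i]; [rewrite inE | move/ball_adj; apply].
  have := c'_par y yB yB'; have : (m <= c' x) = odd j.
    by rewrite /c' xB c_par // inE xB xB'.
  move=> xm ym; apply: contraTneq isT => e; move: xm; rewrite e ym /=.
  by case: (odd j).
exists c'; split=> [x xB|x y xB yB xy|x]; last first.
- by rewrite inE => /andP[xB' xB]; apply: c'_par.
- have [xB'|xB'] := boolP (x \in ball j); have [yB'|yB'] := boolP (y \in ball j).
  + by rewrite /c' xB' yB'; apply: cP.
  + exact: cross.
  + by rewrite eq_sym cross // adj_sym.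
  + by rewrite /c' (negPf xB') (negPf yB') eqn_add2l dP // inE ?xB ?xB' ?yB ?yB'.
rewrite /c'; have [xB'|xB'] := boolP (x \in ball j); first exact: c_lt.
rewrite -addnn -addnS leq_add ?dB //.
by case: (odd _); rewrite ?mul1n.
Qed.

End Ball.

(** The term [c.+1] covers the first two layers, the centre and its neighbours; doubling comes from
    the two palettes. *)
Definition step_bound k c := (layer_bound k c + c.+1).*2.

Lemma locally_col k c S :
  2 < k -> no_pivot_minor_iso (cycle_graph k) G ->
  {in S, forall v, col [set x in S | adj v x] c} -> col S (step_bound k c).
Proof.
move=> k_gt2 noC N_col; apply: contraT => nS.
have [D [/subsetP DS cD nD _]] := component nS.
have [D0|[z zD]] := set_0Vmem D; first by rewrite D0 col0 in nD.
case/negP: nD; apply: (col_layers zD cD) => j.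
have ND v X : v \in D -> {subset X <= D} -> col [set x in X | adj v x] c.
  move=> vD XD; apply: col_sub (N_col v (DS v vD)) => //.
  by apply/subsetP => x; rewrite !inE => /andP[/XD/DS -> ->].
have BD i : {subset ball D z i <= D} by apply/subsetP/ball_sub.
case: j => [|[|i]].
- apply: (@col_sub _ _ [set z] 1).
  + apply/subsetP => x; rewrite /= !inE => /andP[_ /or3P[// | // |]].
    by case/andP=> _ /exists_inP[y]; rewrite inE.
  + by rewrite addnS.
  apply/colP; exists (fun=> 0); split=> // x y; rewrite !inE => /eqP -> /eqP ->.
  by rewrite adj_irrefl.
- have Nz : col [set x in D | adj z x] c by apply: ND.
  apply: (col_sub _ _ Nz); last by rewrite addnS ltnW // ltnS leq_addl.
  apply/subsetP => x; rewrite in_setD => /andP[xB' xB].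
  have [y] := ball_layer xB xB'; rewrite in_setD => /andP[_ yB] yx.
  have yz : y = z.
    move: yB => /setU1P[// | ]; rewrite /= set0U inE.
    by case/andP=> _ /exists_inP[y']; rewrite inE.
  by rewrite inE -yz yx (BD 2).
(* From the third layer on, [X] is the layer, [U] the preceding one and [A] the ball inside [U]. For
   the second layer this ball would be empty and the centre would have no neighbour in it. *)
apply: (col_sub (subxx _) (leq_addr _ _)).
apply: (@layered_col _ k c (ball D z i.+1) (ball D z i.+2 :\: ball D z i.+1)) => //.
- exact: conn_ball.
- rewrite disjoint_sym disjoints_subset; apply/subsetP => x.
  by rewrite in_setD in_setC => /andP[].
- rewrite disjoint_sym disjoints_subset; apply/subsetP => x.
  rewrite in_setD in_setC => /andP[xB _].
  by apply: contra xB; apply/subsetP/ball_subS.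
- rewrite disjoint_sym disjoints_subset; apply/subsetP => x.
  rewrite in_setD in_setC => /andP[xB _].
  by rewrite in_setD negb_and xB orbT.
- move=> a x aB; rewrite in_setD => /andP[xB' xB].
  by apply: contra xB' => ax; apply: ball_adj aB (BD _ _ xB) ax.
- move=> u; rewrite in_setD => /andP[uB' uB].
  have [x] := ball_layer uB uB'; rewrite inE => /andP[_ xB] xu.
  by exists x; rewrite // adj_sym.
- by move=> x; rewrite in_setD => /andP[xB' xB]; apply: ball_layer.
move=> v vUX; apply: ND.
  by case/setUP: vUX => /setDP[vB _]; apply: BD vB.
by move=> x /setDP[xB _]; apply: BD xB.
Qed.

(** * Induction on the clique number *)

Fixpoint chi_bound k n := if n is n'.+1 then step_bound k (chi_bound k n') else 0.

(** A clique among the neighbours of [v] in [S] grows by adding [v], so neighbourhoods obey the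
    bound for [n] smaller by one and [locally_col] applies. *)
Lemma clique_col k n S :
  2 < k -> no_pivot_minor_iso (cycle_graph k) G ->
  (forall K : {set G}, K \subset S -> clique K -> #|K| <= n) ->
  col S (chi_bound k n).
Proof.
move=> k_gt2 noC; elim: n S => [|n IHn] S clique_n.
  have [->|[x xS]] := set_0Vmem S; first exact: col0.
  have := clique_n [set x]; rewrite sub1set xS cards1 => /(_ isT) h.
  suff /h : clique [set x] by [].
  apply/'forall_implyP => a /set1P ->; apply/'forall_implyP => b /set1P ->.
  by rewrite eqxx.
apply: locally_col => // v vS; apply: IHn => K KN cK.
have vK : v \notin K by apply/negP => /(subsetP KN); rewrite inE adj_irrefl andbF.
have := clique_n (v |: K); rewrite cardsU1 vK add1n ltnS; apply.
  rewrite subUset sub1set vS; apply: subset_trans KN _.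
  by apply/subsetP => x; rewrite inE => /andP[].
have vKadj x : x \in K -> adj v x by move/(subsetP KN); rewrite inE => /andP[].
apply/'forall_implyP => a /setU1P[-> | aK]; apply/'forall_implyP => b /setU1P[-> | bK].
- by rewrite eqxx.
- by rewrite vKadj ?implybT.
- by rewrite adj_sym vKadj ?implybT.
by have /'forall_implyP/(_ a aK)/'forall_implyP/(_ b bK) := cK.
Qed.
End Balls.

Theorem theorem4p1 (k : nat) (hk : 3 <= k) :
  chi_bounded (fun G : sgraph => no_pivot_minor_iso (cycle_graph k) G).
Proof.
exists (chi_bound k) => G noC S.
have col_S : colorable (induced S) (chi_bound k (omega (induced S))).
  apply: clique_col => // K KS cK.
  pose K' := [set x : induced S | val x \in K].
  have -> : #|K| = #|K'|.
    rewrite -(card_imset (mem K') val_inj); apply: eq_card => x.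
    apply/idP/imsetP => [xK | [y + ->]]; last by rewrite inE.
    by exists (Sub x (subsetP KS x xK)); rewrite // inE.
  apply: (leq_bigmax_cond (F := fun T : {set induced S} => #|T|)).
  apply/'forall_implyP => a; rewrite inE => aK; apply/'forall_implyP => b.
  rewrite inE => bK; rewrite -val_eqE.
  by have /'forall_implyP/(_ _ aK)/'forall_implyP/(_ _ bK) := cK.
by rewrite /chi; case: ex_minnP => m _; apply.
Qed.
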